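(* Let $R$ be a commutative ring with identity that is a Hilbert ring, and let $R[x]$ be the polynomial ring in one variable over $R$. Then $\mathrm{fPD}(R[x])=\mathrm{fPD}(R)+1$.
   Context: A commutative ring $R$ is called a Hilbert ring (also called a Jacobson ring) if every maximal ideal of $R[X]$ contracts to a maximal ideal of $R$, or equivalently, every prime ideal of $R$ is an intersection of maximal ideals. Small finitistic dimension: for a commutative ring $S$, an $S$-module $M$ has a finite projective resolution if there are an integer $n$ and an exact sequence $0\to P_n\to P_{n-1}\to\cdots\to P_1\to P_0\to M\to 0$ with every $P_i$ a finitely generated projective $S$-module. $\mathrm{fPD}(S)$ is the supremum of the projective dimensions of all $S$-modules having a finite projective resolution (possibly $\infty$; $\infty+1=\infty$). *)

(* Defs.v *)
From HB Require Import structures.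
From mathcomp Require Import all_boot all_order all_algebra.
From mathcomp Require Import boolp classical_sets.

Set Implicit Arguments.
Unset Strict Implicit.
Unset Printing Implicit Defensive.

Import GRing.Theory.
Local Open Scope ring_scope.

(* The library predicate idealr_closed requires 1 \notin I, so it already
   describes proper ideals. *)
Definition maximal_ideal (S : comNzRingType) (I : {pred S}) : Prop :=
  idealr_closed I /\
  forall J : {pred S}, idealr_closed J -> {subset I <= J} -> J =i I.

Definition contraction (R : comNzRingType) (I : {pred {poly R}}) : {pred R} :=
  [pred a | a%:P \in I].

Definition hilbert_ring (R : comNzRingType) : Prop :=
  forall M : {pred {poly R}}, maximal_ideal M -> maximal_ideal (contraction M).

Section Modules.
Variable S : comNzRingType.

Definition fin_generated (M : lmodType S) : Prop :=
  exists (n : nat) (e : 'I_n -> M),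
    forall x : M, exists c : 'I_n -> S, x = \sum_i c i *: e i.

Definition projective (P : lmodType S) : Prop :=
  forall (A B : lmodType S) (g : {linear A -> B}) (f : {linear P -> B}),
    (forall b, exists a, g a = b) ->
    exists h : {linear P -> A}, forall x, g (h x) = f x.

(* An exact sequence 0 -> P_n -> ... -> P_1 -> P_0 -> M -> 0 whose terms P_i
   satisfy C, padded with zero modules in degrees greater than n. Exactness at
   P_n is the statement that P_n -> P_{n-1} (P_0 -> M when n = 0) is
   injective, because P_{n+1} = 0. *)
Definition resolution_of_length (C : lmodType S -> Prop) (M : lmodType S)
    (n : nat) : Prop :=
  exists (P : nat -> lmodType S) (d : forall i, {linear P i.+1 -> P i})
         (eps : {linear P 0%N -> M}),
    [/\ forall i, (i <= n)%N -> C (P i),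
        forall i, (n < i)%N -> forall x : P i, x = 0,
        forall y, exists x, eps x = y,
        forall x, eps x = 0 <-> exists y, d 0%N y = x
      & forall i (x : P i.+1), d i x = 0 <-> exists y, d i.+1 y = x].

Definition has_finite_projective_resolution (M : lmodType S) : Prop :=
  exists n, resolution_of_length (fun P => projective P /\ fin_generated P) M n.

End Modules.

(* Natural numbers extended with infinity; None is infinity. *)
Definition enat : Type := option nat.

Definition enat_le_nat (e : enat) (n : nat) : Prop :=
  if e is Some k then (k <= n)%N else False.

Definition enat_succ (e : enat) : enat := omap succn e.

Definition enat_least (A : nat -> Prop) : enat :=
  match pselect (exists n, `[< A n >]) with
  | left exA => Some (ex_minn exA)
  | right _ => None
  end.

Definition enat_sup (E : set enat) : enat :=
  enat_least (fun n => forall e, E e -> enat_le_nat e n).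

(* The projective dimension of the zero module is 0 here rather than -oo; this
   does not affect fPD, since S itself has projective dimension 0. *)
Definition proj_dim (S : comNzRingType) (M : lmodType S) : enat :=
  enat_least (resolution_of_length (@projective S) M).

Definition fPD (S : comNzRingType) : enat :=
  enat_sup (fun e => exists M : lmodType S,
    has_finite_projective_resolution M /\ proj_dim M = e).

Lemma enat_least_Some (A : nat -> Prop) (n : nat) :
  enat_least A = Some n <-> A n /\ forall m, A m -> (n <= m)%N.
Proof.
rewrite /enat_least; case: pselect => [exA|nA]; last first.
  by split=> // -[An _]; case: nA; exists n; apply/asboolP.
case: ex_minnP => k /asboolP Ak kmin; split=> [[<-]|[An nmin]].
  by split=> // m Am; apply: kmin; apply/asboolP.
by congr Some; apply/eqP; rewrite eqn_leq nmin // kmin //; apply/asboolP.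
Qed.

Lemma enat_least_None (A : nat -> Prop) :
  enat_least A = None <-> forall n, ~ A n.
Proof.
rewrite /enat_least; case: pselect => [exA|nA]; split=> //.
  by move=> nA; have [n /asboolP /nA] := exA.
by move=> _ n An; apply: nA; exists n; apply/asboolP.
Qed.

(* Main.v *)
Require Import Defs.
From HB Require Import structures.
From mathcomp Require Import all_boot all_order all_algebra.
From mathcomp Require Import boolp classical_sets.

(** Both inequalities reduce to one property of a ring S: "every exact complex
    0 -> F_(n+1) -> ... -> F_0 of finitely generated free modules (no condition
    at F_0) has a split first map". It is equivalent to fPD(S) <= n: comparing
    resolutions gives one direction; for the other, syzygies are shown
    projective from the top down, after an Eilenberg swindle replacing
    projectives by free modules.

    If the property holds for R[x] and n+1, the mapping cone of x on the
    extension to R[x] of a complex over R has split first map, and x = 0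
    splits the original complex.

    Conversely let D be the first map of such a complex over R[x]. The a such
    that a 1 = D E for some matrix E form an ideal; if it is proper, it lies in
    a maximal ideal I. As R is Hilbert, the contraction of I is maximal, so I
    contains a monic f. Modulo f, which is regular, the complex becomes one of
    finitely generated free R-modules and stays exact except at F_0 and F_1.
    Hence D mod f has an R-linear left inverse, and an R[x]/(f)-linear one
    because R[x]/(f) is a Frobenius R-algebra. This gives D E = 1 modulo f,
    so det(D E), which is in the ideal, is 1 modulo I: a contradiction. *)

Set Implicit Arguments.
Unset Strict Implicit.
Unset Printing Implicit Defensive.

Import GRing.Theory.
Import Pdiv.CommonRing Pdiv.RingMonic.
Local Open Scope ring_scope.

(** * Quotient modules and lifting *)

Section QuotientModule.
Variables (S : comNzRingType) (M : lmodType S) (N : zmodClosed M).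
Hypothesis scaleN : forall a x, x \in N -> a *: x \in N.

(** The [let] makes [scaleN] a parameter of the type, so that the module instance below can be
    attached to it. *)
Definition quot_mod := let _ := scaleN in Quotient.quot N.
HB.instance Definition _ := GRing.Zmodule.on quot_mod.

Definition quot_mod_pi (x : M) : quot_mod := (\pi_(Quotient.quot N) x)%qT.

Lemma quot_mod_piE x y : quot_mod_pi x = quot_mod_pi y <-> x - y \in N.
Proof. by rewrite Quotient.idealrBE; split=> [e|/eqP //]; apply/eqP. Qed.

Lemma quot_mod_pi_repr (q : quot_mod) : quot_mod_pi (repr q) = q.
Proof. exact: reprK. Qed.

Lemma quot_mod_piD x y : quot_mod_pi (x + y) = quot_mod_pi x + quot_mod_pi y.
Proof. exact: Quotient.pi_add. Qed.

Definition quot_mod_scale a (q : quot_mod) : quot_mod := quot_mod_pi (a *: repr q).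

Lemma quot_mod_scaleE a x : quot_mod_scale a (quot_mod_pi x) = quot_mod_pi (a *: x).
Proof.
by apply/quot_mod_piE; rewrite -scalerBr scaleN //; apply/quot_mod_piE/quot_mod_pi_repr.
Qed.

Fact quot_mod_scalerA a b q :
  quot_mod_scale a (quot_mod_scale b q) = quot_mod_scale (a * b) q.
Proof. by rewrite -(quot_mod_pi_repr q) !quot_mod_scaleE scalerA. Qed.

Fact quot_mod_scale1r : left_id 1 quot_mod_scale.
Proof. by move=> q; rewrite -(quot_mod_pi_repr q) quot_mod_scaleE scale1r. Qed.

Fact quot_mod_scalerDr : right_distributive quot_mod_scale +%R.
Proof.
move=> a p q; rewrite -(quot_mod_pi_repr p) -(quot_mod_pi_repr q).
by rewrite -quot_mod_piD !quot_mod_scaleE -quot_mod_piD scalerDr.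
Qed.

Fact quot_mod_scalerDl q : {morph quot_mod_scale^~ q : a b / a + b}.
Proof.
by move=> a b; rewrite -(quot_mod_pi_repr q) !quot_mod_scaleE -quot_mod_piD scalerDl.
Qed.

HB.instance Definition _ := GRing.Zmodule_isLmodule.Build S quot_mod
  quot_mod_scalerA quot_mod_scale1r quot_mod_scalerDr quot_mod_scalerDl.

Fact quot_mod_pi_linear : linear quot_mod_pi.
Proof. by move=> a x y; rewrite quot_mod_piD -quot_mod_scaleE. Qed.

HB.instance Definition _ := GRing.isLinear.Build S M quot_mod *:%R quot_mod_pi
  quot_mod_pi_linear.

End QuotientModule.

Section Modules.
Variable S : comNzRingType.
Implicit Types X Y Z P : lmodType S.

Lemma quotient_exists X (N : X -> Prop) :
  N 0 -> (forall a x y, N x -> N y -> N (a *: x + y)) ->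
  exists (Q : lmodType S) (p : {linear X -> Q}),
    (forall q, exists x, p x = q) /\ (forall x, p x = 0 <-> N x).
Proof.
move=> N0 Nl; pose Nb : {pred X} := [pred x | `[< N x >]].
have Ncl : zmod_closed Nb.
  split=> [|x y /asboolP Nx /asboolP Ny]; first exact/asboolP.
  by apply/asboolP; rewrite addrC -scaleN1r; apply: Nl.
pose Nc : zmodClosed X := HB.pack Nb (GRing.isZmodClosed.Build X Nb Ncl).
have scaleN a x : x \in Nc -> a *: x \in Nc.
  by move=> /asboolP Nx; apply/asboolP; rewrite -[_ *: x]addr0; apply: Nl.
exists (quot_mod scaleN), (quot_mod_pi scaleN); split=> [q|x].
  by exists (repr q); apply: quot_mod_pi_repr.
rewrite -(linear0 (quot_mod_pi scaleN)) quot_mod_piE subr0.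
by split=> [/asboolP|Nx] //; apply/asboolP.
Qed.

Lemma linear_ex X Y (f : X -> Y) : linear f -> exists g : {linear X -> Y}, g =1 f.
Proof.
move=> fl; pose g : {linear X -> Y} := HB.pack f (GRing.isLinear.Build S X Y *:%R f fl).
by exists g.
Qed.

(** Subtracting two values at the same point gives a value at 0, so any choice function for [G] is
    forced to be linear. *)
Lemma linear_of_graph X Y (G : X -> Y -> Prop) :
  (forall x, exists y, G x y) -> (forall y, G 0 y -> y = 0) ->
  (forall a x y x' y', G x y -> G x' y' -> G (a *: x + x') (a *: y + y')) ->
  exists f : {linear X -> Y}, forall x, G x (f x).
Proof.
move=> Gtot G0 Gl; have [f Gf] := choice Gtot.
suff /linear_ex[g gE] : linear f by exists g => x; rewrite gE.
move=> a x y; apply/eqP; rewrite -subr_eq0; apply/eqP/G0.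
have /(Gl (-1)) := Gl a _ _ _ _ (Gf x) (Gf y).
move=> /(_ _ _ (Gf (a *: x + y))).
by rewrite !scaleN1r addNr [X in G 0 X]addrC.
Qed.

Lemma factor_through X Y Z (p : {linear X -> Z}) (g : {linear X -> Y}) :
  (forall z, exists x, p x = z) -> (forall x, p x = 0 -> g x = 0) ->
  exists h : {linear Z -> Y}, forall x, h (p x) = g x.
Proof.
move=> psurj kerg.
have [| y [x [<- /kerg]]|a z y z' y'|h hG] :=
    @linear_of_graph Z Y (fun z y => exists x, g x = y /\ p x = z).
- by move=> z; have [x <-] := psurj z; exists (g x), x.
- by [].
- by move=> [x [<- <-]] [x' [<- <-]]; exists (a *: x + x'); rewrite !linearP.
exists h => x; have [x' [<- e]] := hG (p x).
by apply/eqP; rewrite -subr_eq0 -linearB; apply/eqP/kerg; rewrite linearB e subrr.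
Qed.

(* The definition of projectivity only lifts through surjections; replacing X
   by its coimage X / ker d handles a map d that is not surjective. *)
Lemma projective_lift P X Y (g : {linear P -> Y}) (d : {linear X -> Y}) :
  projective P -> (forall p, exists x, d x = g p) ->
  exists h : {linear P -> X}, forall p, d (h p) = g p.
Proof.
move=> Pproj gd.
have [||B [q [qsurj kerq]]] := @quotient_exists X (fun x => d x = 0).
- exact: linear0.
- by move=> a x y dx dy; rewrite linearP dx dy scaler0 addr0.
have [|b|a x b x' b'|gb gbG] :=
    @linear_of_graph P B (fun p b => exists x, q x = b /\ d x = g p).
- by move=> p; have [x dx] := gd p; exists (q x), x.
- by move=> [x [<- ]]; rewrite linear0 => /kerq.
- by move=> [y [<- dy]] [y' [<- dy']]; exists (a *: y + y'); rewrite !linearP dy dy'.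
have [h hE] := Pproj X B q gb qsurj; exists h => p.
have [x [qx <-]] := gbG p.
apply/eqP; rewrite -subr_eq0 -linearB; apply/eqP/kerq.
by rewrite linearB hE qx subrr.
Qed.

End Modules.

(** * Resolutions by finitely generated projective modules *)

Lemma enat_least_le (A : nat -> Prop) (n : nat) :
  enat_le_nat (enat_least A) n <-> exists2 k, (k <= n)%N & A k.
Proof.
case E: (enat_least A) => [k|] /=.
  have [Ak kmin] := (enat_least_Some A k).1 E.
  by split=> [kn|[l ln /kmin kl]]; [exists k | apply: leq_trans kl ln].
by split=> // -[k _ /((enat_least_None A).1 E)].
Qed.

Lemma enat_sup_le (E : set enat) (n : nat) :
  enat_le_nat (enat_sup E) n <-> forall e, E e -> enat_le_nat e n.
Proof.
rewrite /enat_sup enat_least_le; split=> [[k kn Ek] e /Ek|En]; last by exists n.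
by case: e => //= m mk; apply: leq_trans mk kn.
Qed.

Lemma fPD_le (S : comNzRingType) (n : nat) :
  enat_le_nat (fPD S) n <->
  forall M : lmodType S, has_finite_projective_resolution M ->
    exists2 k, (k <= n)%N & resolution_of_length (@projective S) M k.
Proof.
rewrite enat_sup_le; split=> [En M FM|En e [M [FM <-]]].
  by apply/enat_least_le/En; exists M.
exact/enat_least_le/En.
Qed.

Lemma eq_enat_le (e e' : enat) :
  (forall n, enat_le_nat e n <-> enat_le_nat e' n) -> e = e'.
Proof.
case: e e' => [m|] [m'|] //= H.
- by congr Some; apply/eqP; rewrite eqn_leq; apply/andP; split; apply/H.
- by have := (H m).1 (leqnn m).
- by have := (H m').2 (leqnn m').
Qed.

Section FinGenProj.
Variable S : comNzRingType.
Implicit Types (X Y Z P : lmodType S) (n : nat).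

Definition fg_projective P := projective P /\ fin_generated P.

Definition left_invertible X Y (j : {linear X -> Y}) :=
  exists r : {linear Y -> X}, cancel j r.

Lemma projective_retract P X (i : {linear X -> P}) (p : {linear P -> X}) :
  cancel i p -> projective P -> projective X.
Proof.
move=> ip Pproj A B g f gsurj.
have [h hE] := Pproj A B g (f \o p) gsurj.
by exists (h \o i) => x; rewrite /= hE /= ip.
Qed.

Lemma fin_generated_surj X Y (p : {linear X -> Y}) :
  (forall y, exists x, p x = y) -> fin_generated X -> fin_generated Y.
Proof.
move=> psurj [n [e eX]]; exists n, (p \o e) => y; have [x <-] := psurj y.
have [c ->] := eX x; exists c; rewrite linear_sum.
by apply: eq_bigr => i _; rewrite linearZ.
Qed.

Lemma fg_projective_retract P X (i : {linear X -> P}) (p : {linear P -> X}) :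
  cancel i p -> fg_projective P -> fg_projective X.
Proof.
move=> ip [Pproj Pfg]; split; first exact: projective_retract ip Pproj.
by apply: (fin_generated_surj (p := p)) => // x; exists (i x).
Qed.

Lemma linear_from_rV n Y (e : 'I_n -> Y) :
  exists f : {linear 'rV[S]_n -> Y}, forall v, f v = \sum_i v 0 i *: e i.
Proof.
have [|f fE] := @linear_ex S 'rV[S]_n Y (fun v => \sum_i v 0 i *: e i).
  move=> a u v; rewrite scaler_sumr -big_split.
  by apply: eq_bigr => i _; rewrite !mxE scalerDl scalerA.
by exists f.
Qed.

Lemma fg_projective_rV n : fg_projective 'rV[S]_n.
Proof.
split=> [A B g f gsurj|]; last first.
  exists n, (fun i => delta_mx 0 i) => x; exists (x 0); exact: row_sum_delta.
have [e eE] := choice (fun i => gsurj (f (delta_mx 0 i))).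
have [h hE] := linear_from_rV e; exists h => x.
rewrite hE linear_sum {2}(row_sum_delta x) linear_sum.
by apply: eq_bigr => i _; rewrite !linearZ /= eE.
Qed.

Lemma fg_projective_mx m n : fg_projective 'M[S]_(m, n).
Proof.
exact: (@fg_projective_retract _ _ (@mxvec S m n) (@vec_mx S m n) (@mxvecK S m n)
          (fg_projective_rV _)).
Qed.

Lemma fg_projective_zero X : (forall x : X, x = 0) -> fg_projective X.
Proof.
move=> X0; apply: (@fg_projective_retract 'rV[S]_0 _ \0 \0) (fg_projective_rV 0).
by move=> x; rewrite [RHS]X0.
Qed.

Lemma fg_projective_rV_retract X : fg_projective X ->
  exists n (p : {linear 'rV[S]_n -> X}) (i : {linear X -> 'rV[S]_n}), cancel i p.
Proof.
move=> [Xproj [n [e eX]]]; have [p pE] := linear_from_rV e; exists n, p.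
have psurj x : exists v, p v = x.
  have [c ->] := eX x; exists (\row_i c i); rewrite pE.
  by apply: eq_bigr => i _; rewrite mxE.
have [i iE] := Xproj _ _ p idfun psurj.
by exists i.
Qed.

(** The last module is exempt from exactness. In [proj_mono_split n], X thus sits in degree n+1, Y
    in degree n, and the tail ends in degree 0. *)
Fixpoint exact_tail (m : nat) X Y (j : {linear X -> Y}) : Prop :=
  if m is m'.+1 then
    exists (Z : lmodType S) (d : {linear Y -> Z}),
      [/\ fg_projective Z, forall y, d y = 0 <-> exists x, j x = y
        & exact_tail m' d]
  else True.

Definition proj_mono_split n := forall X Y (j : {linear X -> Y}),
  fg_projective X -> fg_projective Y -> (forall x, j x = 0 -> x = 0) ->
  exact_tail n j -> left_invertible j.

Definition exact_family (P : nat -> lmodType S) (d : forall i, {linear P i.+1 -> P i}) :=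
  forall i (x : P i.+1), d i x = 0 <-> exists y, d i.+1 y = x.

Lemma exact_family_comp0 (P : nat -> lmodType S) (d : forall i, {linear P i.+1 -> P i}) :
  exact_family d -> forall i y, d i (d i.+1 y) = 0.
Proof. by move=> dE i y; apply/dE; exists y. Qed.

(* The identity of P is homotopic to its composite through Q. The maps a and
   b (chain maps) and h (the homotopy) are extended one degree at a time by
   shifting both complexes; the hypotheses only see them on boundaries. Where
   Q vanishes, the homotopy is a left inverse of d. *)
Lemma homotopy_left_invertible n :
  forall (P Q : nat -> lmodType S) (d : forall i, {linear P i.+1 -> P i})
         (d' : forall i, {linear Q i.+1 -> Q i}),
  (forall i, projective (P i)) -> (forall i, projective (Q i)) ->
  exact_family d -> exact_family d' ->
  forall (a : {linear P 0%N -> Q 0%N}) (b : {linear Q 0%N -> P 0%N})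
         (h : {linear P 0%N -> P 1%N}),
  (forall y, exists z, d' 0%N z = a (d 0%N y)) ->
  (forall z, exists y, d 0%N y = b (d' 0%N z)) ->
  (forall y, d 0%N y - b (a (d 0%N y)) = d 0%N (h (d 0%N y))) ->
  (forall x : Q n.+1, x = 0) -> (forall x : P n.+2, x = 0) ->
  left_invertible (d n).
Proof.
elim: n => [|n IHn] P Q d d' Pp Qp dE d'E a b h ad bd hE Q0 P0;
  have [a1 a1E] := @projective_lift _ _ _ _ (a \o d 0%N) (d' 0%N) (Pp 1%N) ad;
  have [b1 b1E] := @projective_lift _ _ _ _ (b \o d' 0%N) (d 0%N) (Qp 1%N) bd;
  pose t : {linear P 1%N -> P 1%N} := idfun \- (b1 \o a1) \- (h \o d 0%N);
  have tE y : t y = y - b1 (a1 y) - h (d 0%N y) by [].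
all: have d0t y : d 0%N (t y) = 0
  by rewrite tE !linearB b1E /= a1E /= hE subrr.
- exists h => y; have [z zE] := (dE _ _).1 (d0t y).
  move: zE; rewrite [z]P0 linear0 tE [a1 y]Q0 linear0 subr0 => /esym/eqP.
  by rewrite subr_eq0 => /eqP.
have [h1 h1E] := projective_lift (Pp 1%N) (fun y => (dE _ _).1 (d0t y)).
apply: (IHn (fun i => P i.+1) (fun i => Q i.+1) (fun i => d i.+1)
            (fun i => d' i.+1) (fun i => Pp i.+1) (fun i => Qp i.+1)
            (fun i => dE i.+1) (fun i => d'E i.+1) a1 b1 h1) => //.
- by move=> y; apply/d'E; rewrite a1E /= (exact_family_comp0 dE) linear0.
- by move=> y; apply/dE; rewrite b1E /= (exact_family_comp0 d'E) linear0.
by move=> y; rewrite h1E tE (exact_family_comp0 dE) linear0 subr0.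
Qed.

Lemma coker_exists X Y (d : {linear X -> Y}) :
  exists (Q : lmodType S) (p : {linear Y -> Q}),
    (forall q, exists y, p y = q) /\ (forall y, p y = 0 <-> exists x, d x = y).
Proof.
apply: quotient_exists; first by exists 0; rewrite linear0.
by move=> a _ _ [x <-] [y <-]; exists (a *: x + y); rewrite linearP.
Qed.

(** The tail is prepended one module at a time, which moves degree k to m + k. Identifying
    [P' (m + k)] with [P k] would need casts, so only vanishing and splitting are carried over. *)
Lemma exact_tail_family m :
  forall (P : nat -> lmodType S) (d : forall i, {linear P i.+1 -> P i}),
  (forall i, fg_projective (P i)) -> exact_family d -> exact_tail m (d 0%N) ->
  exists (P' : nat -> lmodType S) (d' : forall i, {linear P' i.+1 -> P' i}),
  [/\ forall i, fg_projective (P' i), exact_family d',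
      forall k, (forall i, (k <= i)%N -> forall x : P i, x = 0) ->
        forall i, (m + k <= i)%N -> forall x : P' i, x = 0
    & forall k, left_invertible (d' (m + k)%N) -> left_invertible (d k)].
Proof.
elim: m => [|m IHm] P d Pp dE /=; first by move=> _; exists P, d.
move=> [Z [e [Zp eE eT]]].
pose P1 i := if i is i'.+1 then P i' else Z.
pose d1 i : {linear P1 i.+1 -> P1 i} :=
  match i return {linear P1 i.+1 -> P1 i} with 0%N => e | i'.+1 => d i' end.
have P1p i : fg_projective (P1 i) by case: i.
have d1E : exact_family d1 by case.
have [P' [d' [P'p d'E P'0 d's]]] := IHm P1 d1 P1p d1E eT.
exists P', d'; split=> // k.
  by move=> P0; rewrite addSnnS; apply: P'0 => -[|i] //=; apply: P0.
by rewrite addSnnS => /d's.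
Qed.

(** The complex resolves the cokernel of its last map in length n+1. Comparison with a projective
    resolution of length at most n makes the identity homotopic to a map that vanishes in degree
    n+1. *)
Lemma fPD_le_proj_mono_split n : enat_le_nat (fPD S) n -> proj_mono_split n.
Proof.
move=> /fPD_le fPDn X Y j Xp Yp jinj jT.
pose P i : lmodType S := match i with 0%N => Y | 1%N => X | _ => 'rV[S]_0 end.
pose d i : {linear P i.+1 -> P i} :=
  match i return {linear P i.+1 -> P i} with 0%N => j | _ => \0 end.
have P0 i : (2 <= i)%N -> forall x : P i, x = 0.
  by case: i => [|[|i]] // _ x; apply: thinmx0.
have Pp i : fg_projective (P i).
  by case: i => [|[|i]] //; apply: fg_projective_rV.
have dE : exact_family d.
  case=> [|i] x; first by split=> [/jinj->|[y <-]]; [exists 0 | rewrite linear0].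
  by split=> // _; exists 0; rewrite [RHS]P0.
have [P' [d' [P'p d'E P'0 d's]]] := exact_tail_family Pp dE jT.
have {}P'0 := P'0 _ P0.
have [M [eps [epss epsE]]] := coker_exists (d' 0%N).
have [|k kn [Q [d'' [eps'' [Qp Q0 eps''s eps''E d''E]]]]] := fPDn M.
  exists n.+1, P', d', eps; split=> // i ni; first exact: P'p.
  by apply: P'0; rewrite addn2.
have {}Qp i : projective (Q i).
  by have [/Qp//|/Q0/fg_projective_zero[]] := leqP i k.
have {}P'p i : projective (P' i) by case: (P'p i).
have [a aE] := @projective_lift _ _ _ _ eps eps'' (P'p 0%N) (fun p => eps''s (eps p)).
have [b bE] := @projective_lift _ _ _ _ eps'' eps (Qp 0%N) (fun p => epss (eps'' p)).
pose t : {linear P' 0%N -> P' 0%N} := idfun \- (b \o a).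
have tE y : t y = y - b (a y) by [].
have epst y : eps (t y) = 0 by rewrite tE linearB bE aE subrr.
have [h hE] := projective_lift (P'p 0%N) (fun y => (epsE _).1 (epst y)).
have := d's 0%N; rewrite addn0; apply.
apply: (homotopy_left_invertible P'p Qp d'E d''E (a := a) (b := b) (h := h)).
- by move=> y; apply/eps''E; rewrite aE; apply/epsE; exists y.
- by move=> y; apply/epsE; rewrite bE; apply/eps''E; exists y.
- by move=> y; rewrite hE tE.
- by apply: Q0; rewrite ltnS.
- by apply: P'0; rewrite addn2.
Qed.

Lemma exact_family_tail (P : nat -> lmodType S) (d : forall i, {linear P i.+1 -> P i}) :
  (forall i, fg_projective (P i)) -> exact_family d ->
  forall m k X (j : {linear X -> P (m + k)%N}),
  (forall y, (exists x, j x = y) <-> (exists z, d (m + k)%N z = y)) -> exact_tail m j.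
Proof.
move=> Pp dE; elim=> [|m IHm] k X j jE //=.
exists (P (m + k)%N), (d (m + k)%N); split=> // [y|]; first by rewrite dE jE.
exact: IHm.
Qed.

(** Descending induction on the degree, [t] bounding the distance to N. The cokernel K' one degree
    up embeds in [P i] with image the kernel of p, and n <= i leaves room for an exact tail of
    length n; so the embedding splits and K is a summand of [P i]. *)
Lemma coker_projective n (P : nat -> lmodType S) (d : forall i, {linear P i.+1 -> P i}) N :
  proj_mono_split n -> (forall i, fg_projective (P i)) -> exact_family d ->
  (forall i, (N < i)%N -> forall x : P i, x = 0) ->
  forall t i (K : lmodType S) (p : {linear P i -> K}), (N < i + t)%N -> (n <= i)%N ->
  (forall q, exists x, p x = q) -> (forall x, p x = 0 <-> exists y, d i y = x) ->
  projective K.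
Proof.
move=> splitn Pp dE P0; elim=> [|t IHt] i K p.
  rewrite addn0 => /P0 Pi0 _ ps _; have [] // := @fg_projective_zero K.
  by move=> q; have [x <-] := ps q; rewrite [x]Pi0 linear0.
move=> Nit ni ps pE.
have [k ik] : exists k, i = (n + k)%N by exists (i - n)%N; rewrite subnKC.
subst i; set i := (n + k)%N in p Nit ni ps pE *.
have [K' [p' [p's p'E]]] := coker_exists (d i.+1).
have K'p : projective K' by apply: IHt p's p'E; rewrite ?addSnnS ?leqW.
have K'fg : fin_generated K' by apply: (fin_generated_surj p's); case: (Pp i.+1).
have [|j jE] := @factor_through _ _ _ _ p' (d i) p's.
  by move=> x /p'E/dE.
have jim x : (exists z, j z = x) <-> (exists y, d i y = x).
  split=> [[z <-]|[y <-]]; last by exists (p' y).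
  by have [y <-] := p's z; exists y.
have [r rE] : left_invertible j.
  apply: splitn; [by split | exact: Pp | |].
    move=> z; have [x <-] := p's z; rewrite jE => /dE [y <-].
    by apply/p'E; exists y.
  exact: (exact_family_tail Pp dE jim).
(* The complementary projection kills the image of j, hence factors through p and yields a section
   of p. *)
pose t' : {linear P i -> P i} := idfun \- (j \o r).
have t'E y : t' y = y - j (r y) by [].
have [x /pE/jim[z <-]|s sE] := @factor_through _ _ _ _ p t' ps.
  by rewrite t'E rE subrr.
apply: (@projective_retract (P i) K s p) (Pp i).1 => q.
have [x <-] := ps q; rewrite sE t'E linearB.
by have /pE-> := (jim _).1 (ex_intro _ (r x) erefl); rewrite subr0.
Qed.

(** The truncation of the shifted family resolves the cokernel of [d 1], which is the image of
    [d 0]; it is spliced with [P 0] through j. *)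
Lemma truncated_resolution n :
  forall (P : nat -> lmodType S) (d : forall i, {linear P i.+1 -> P i}),
  (forall i, projective (P i)) -> exact_family d ->
  forall (K : lmodType S) (p : {linear P n -> K}),
  (forall q, exists x, p x = q) -> (forall x, p x = 0 <-> exists y, d n y = x) ->
  projective K ->
  forall (M : lmodType S) (eps : {linear P 0%N -> M}),
  (forall q, exists x, eps x = q) -> (forall x, eps x = 0 <-> exists y, d 0%N y = x) ->
  resolution_of_length (@projective S) M n.
Proof.
elim: n => [|n IHn] P d Pp dE K p ps pE Kp M eps epss epsE.
  (* Both p and eps are cokernels of [d 0], so g is an isomorphism and K alone resolves M. *)
  have [x /pE/epsE//|g gE] := @factor_through _ _ _ _ p eps ps.
  pose P' i : lmodType S := if i is 0%N then K else 'rV[S]_0.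
  have P'0 i (x : P' i.+1) : x = 0 by apply: thinmx0.
  exists P', (fun i => \0), g; split.
  - by case.
  - by case.
  - by move=> y; have [x <-] := epss y; exists (p x); rewrite gE.
  - move=> q; split=> [|[y <-]]; last by rewrite linear0.
    have [x <-] := ps q; rewrite gE => /epsE/pE->.
    by exists 0.
  - by move=> i x; split=> // _; exists 0; rewrite [RHS]P'0.
have [K1 [p1 [p1s p1E]]] := coker_exists (d 1%N).
have [|P' [d' [eps' [P'p P'0 eps's eps'E d'E]]]] :=
  IHn (fun i => P i.+1) (fun i => d i.+1) (fun i => Pp i.+1) _ K p ps pE Kp K1 p1 p1s p1E.
  exact: (fun i => dE i.+1).
have [x /p1E/dE//|j jE] := @factor_through _ _ _ _ p1 (d 0%N) p1s.
pose P1 i := if i is i'.+1 then P' i' else P 0%N.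
pose d1 i : {linear P1 i.+1 -> P1 i} :=
  match i return {linear P1 i.+1 -> P1 i} with 0%N => j \o eps' | i'.+1 => d' i' end.
exists P1, d1, eps; split=> //.
- by case=> [|i] //= /P'p.
- by case=> [|i] //= /P'0.
- move=> x; rewrite epsE; split=> [[y <-]|[y <-]] /=.
    by have [z zE] := eps's (p1 y); exists z; rewrite zE jE.
  by have [z <-] := p1s (eps' y); exists z; rewrite jE.
- case=> [|i] x; last exact: d'E.
  apply: iff_trans (eps'E x); split=> [|/= ->]; last by rewrite linear0.
  move=> /=; have [z <-] := p1s (eps' x); rewrite jE => /dE [y <-].
  by apply/p1E; exists y.
Qed.

Lemma proj_mono_split_fPD_le n : proj_mono_split n -> enat_le_nat (fPD S) n.
Proof.
move=> splitn; apply/fPD_le => M [N [P [d [eps [Pp P0 epss epsE dE]]]]].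
have {}Pp i : fg_projective (P i).
  by have [/Pp//|/P0/fg_projective_zero] := leqP i N.
have [K [p [ps pE]]] := coker_exists (d n).
exists n => //; apply: (truncated_resolution _ dE ps pE _ epss epsE).
  by move=> i; case: (Pp i).
by apply: (coker_projective splitn Pp dE P0 (t := N.+1)) ps pE; rewrite ?addnS ?ltnS ?leq_addl.
Qed.

End FinGenProj.

(** * Complexes of free modules *)

Section MatrixChains.
Variable S : comNzRingType.
Implicit Types (X Y Z : lmodType S) (m n r s t : nat).

Definition exact_mx r s t (D : 'M[S]_(r, s)) (E : 'M[S]_(s, t)) :=
  forall v : 'rV_s, v *m E = 0 <-> exists w, w *m D = v.

Fixpoint mx_tail m r s (D : 'M[S]_(r, s)) : Prop :=
  if m is m'.+1 then exists t (E : 'M[S]_(s, t)), exact_mx D E /\ mx_tail m' E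
  else True.

Definition mx_mono_split n := forall r s (D : 'M[S]_(r, s)),
  (forall v : 'rV_r, v *m D = 0 -> v = 0) -> mx_tail n D ->
  exists E, D *m E = 1%:M.

Lemma mx_tail_exact_tail m r s (D : 'M[S]_(r, s)) :
  mx_tail m D -> exact_tail m (mulmxr D : {linear 'rV_r -> 'rV_s}).
Proof.
elim: m r s D => [|m IHm] r s D //= [t [E [DE /IHm ET]]].
by exists 'rV_t, (mulmxr E); split=> //; apply: fg_projective_rV.
Qed.

Lemma proj_mono_split_mx n : proj_mono_split S n -> mx_mono_split n.
Proof.
move=> splitn r s D Dinj /mx_tail_exact_tail DT.
have [f fK] := splitn _ _ (mulmxr D) (fg_projective_rV S r) (fg_projective_rV S s) Dinj DT.
exists (lin1_mx f); apply/row_matrixP => i.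
by rewrite rowE mulmxA mul_rV_lin1 -[_ *m D]/(mulmxr D _) fK rowE mulmx1.
Qed.

(* The projector c need not be the one along X: its kernel may exceed X. *)
Definition summand X r (p : {linear 'rV[S]_r -> X}) (i : {linear X -> 'rV[S]_r})
    (c : {linear 'rV[S]_r -> 'rV[S]_r}) :=
  [/\ cancel i p, forall w, c (c w) = c w, forall w, p (c w) = 0 & forall x, c (i x) = 0].

Lemma linear_row_mx X s r (f : {linear X -> 'rV[S]_s}) (g : {linear X -> 'rV[S]_r}) :
  exists h : {linear X -> 'rV[S]_(s + r)}, forall x, h x = row_mx (f x) (g x).
Proof.
have [|h hE] := @linear_ex _ X 'rV[S]_(s + r) (fun x => row_mx (f x) (g x)).
  by move=> a u v; rewrite scale_row_mx add_row_mx !linearP.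
by exists h.
Qed.

(* Eilenberg swindle: D copies the image of c into an extra free summand, so
   that it kills exactly what both c and d kill. *)
Lemma summand_step X Y (d : {linear X -> Y}) r p i c :
  @summand X r p i c -> fg_projective Y ->
  exists r' (p' : {linear 'rV[S]_r' -> Y}) (i' : {linear Y -> 'rV[S]_r'})
    (c' : {linear 'rV[S]_r' -> 'rV[S]_r'}) (D : 'M[S]_(r, r')),
    [/\ summand p' i' c',
        forall w, w *m D = 0 <-> d (p w) = 0 /\ c w = 0,
        forall w', (exists w, w *m D = w') <-> (exists x, d x = p' w') /\ c' w' = 0
      & forall x, i x *m D = i' (d x)].
Proof.
move=> [iK cc pc ci] /fg_projective_rV_retract [s [pY [iY iYK]]].
pose p' : {linear 'rV[S]_(s + r) -> Y} := pY \o lsubmx.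
have p'E w : p' w = pY (lsubmx w) by [].
have [i' i'E] := linear_row_mx iY (\0 : {linear Y -> 'rV[S]_r}).
have [c' c'E] := linear_row_mx
  ((idfun \- (iY \o pY)) \o lsubmx : {linear 'rV[S]_(s + r) -> 'rV[S]_s})
  ((idfun \- c) \o rsubmx : {linear 'rV[S]_(s + r) -> 'rV[S]_r}).
have [D DE] := linear_row_mx (iY \o d \o p) c.
have {}i'E y : i' y = row_mx (iY y) 0 by rewrite i'E.
have {}DE w : D w = row_mx (iY (d (p w))) (c w) by rewrite DE.
have {}c'E w : c' w =
    row_mx (lsubmx w - iY (pY (lsubmx w))) (rsubmx w - c (rsubmx w)) by rewrite c'E.
have iY0 y : iY y = 0 -> y = 0 by move=> /(congr1 pY); rewrite iYK linear0.
exists (s + r)%N, p', i', c', (lin1_mx D); split.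
- split.
  + by move=> y; rewrite p'E i'E row_mxKl iYK.
  + by move=> w; rewrite !c'E row_mxKl row_mxKr !linearB /= !iYK !cc !subrr ?oppr0 !addr0.
  + by move=> w; rewrite p'E c'E row_mxKl linearB iYK subrr.
  + by move=> y; rewrite c'E i'E row_mxKl row_mxKr iYK linear0 !subrr; exact: row_mx0.
- move=> w; rewrite mul_rV_lin1 DE; split=> [|[-> ->]]; last by rewrite linear0 row_mx0.
  by rewrite -row_mx0 => /eq_row_mx [/iY0].
- move=> w'; split=> [[w <-]|[[x xE]]].
    rewrite mul_rV_lin1 DE p'E c'E row_mxKl row_mxKr iYK cc !subrr row_mx0.
    by split=> //; exists (p w).
  rewrite c'E -row_mx0 => /eq_row_mx [/subr0_eq lE /subr0_eq rE].
  have pr : p (rsubmx w') = 0 by rewrite rE pc.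
  (* The two summands produce the two blocks separately: c kills [i x], while p kills [rsubmx w'],
     which c fixes. *)
  exists (i x + rsubmx w'); rewrite mul_rV_lin1 DE (linearD p) (linearD c) iK pr ci.
  by rewrite addr0 add0r -rE xE p'E -lE hsubmxK.
- by move=> x; rewrite mul_rV_lin1 DE iK ci i'E.
Qed.

(** [summand_step] describes the kernel and the image of its matrix in the shape of the hypothesis
    on D, so exactness of matrices reduces to exactness of j and d. *)
Lemma exact_tail_mx_tail m X Y (j : {linear X -> Y}) r p i c q (D : 'M[S]_(q, r)) :
  @summand Y r p i c -> exact_tail m j ->
  (forall w, (exists v, v *m D = w) <-> (exists x, j x = p w) /\ c w = 0) ->
  mx_tail m D.
Proof.
elim: m X Y j r p i c q D => [|m IHm] X Y j r p i c q D //= Ysum [Z [d [Zp dE dT]]] imD.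
have [r' [p' [i' [c' [D' [Zsum kerD' imD' _]]]]]] := summand_step d Ysum Zp.
exists r', D'; split; last exact: IHm Zsum dT imD'.
by move=> w; rewrite kerD' imD dE.
Qed.

(** The swindle completes X and all later modules to free ones. As D restricts to j along i and i',
    a right inverse matrix of D compresses to a left inverse of j. *)
Lemma mx_mono_split_proj n : mx_mono_split n -> proj_mono_split S n.
Proof.
move=> splitn X Y j /fg_projective_rV_retract [r [p [i iK]]] Yp jinj jT.
pose c : {linear 'rV[S]_r -> 'rV[S]_r} := idfun \- (i \o p).
have cE w : c w = w - i (p w) by [].
have Xsum : summand p i c.
  by split=> [//|w|w|x]; rewrite !cE ?linearB /= !iK ?subrr ?oppr0 ?addr0.
have [r' [p' [i' [c' [D [Ysum kerD imD DE]]]]]] := summand_step j Xsum Yp.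
have [|E DE1] := splitn _ _ D _ (exact_tail_mx_tail Ysum jT imD).
  by move=> w /kerD [/jinj pw]; rewrite cE pw linear0 subr0.
exists (p \o mulmxr E \o i') => x.
by rewrite /= -DE -mulmxA DE1 mulmx1 iK.
Qed.

Lemma exact_mx_mul0 r s t (D : 'M[S]_(r, s)) (E : 'M[S]_(s, t)) :
  exact_mx D E -> D *m E = 0.
Proof.
move=> DE; apply/row_matrixP => i; rewrite row_mul row0; apply/DE.
by exists (delta_mx 0 i); rewrite rowE.
Qed.

End MatrixChains.

(** * The mapping cone of the variable *)

Section ConeOfX.
Variable R : comNzRingType.
Local Notation A := {poly R}.

Lemma monic_scale_mx_eq0 (f : A) m n (v : 'M[A]_(m, n)) :
  f \is monic -> f *: v = 0 -> v = 0.
Proof.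
move=> fmon /matrixP fv; apply/matrixP => i j; apply: (monic_lreg fmon).
by have := fv i j; rewrite !mxE mulr0.
Qed.

Lemma row_poly_decomp n (u : 'rV[A]_n) :
  exists u', u = map_mx polyC (map_mx (horner_eval 0) u) + 'X *: u'.
Proof.
exists (map_mx (drop_poly 1) u); apply/rowP => i; rewrite !mxE.
rewrite -{1}(poly_take_drop 1 (u 0 i)) expr1 [_ * 'X]mulrC; congr (_ + _).
apply/polyP => k; rewrite coef_take_poly coefC /= /horner_eval horner_coef0.
by case: k.
Qed.

Lemma map_polyC_horner0 m n (D : 'M[R]_(m, n)) :
  map_mx (horner_eval 0) (map_mx polyC D) = D.
Proof. by apply/matrixP => i j; rewrite !mxE /horner_eval hornerC. Qed.

(* A differential of the mapping cone of multiplication by 'X. *)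
Definition cone r s t (D : 'M[R]_(r, s)) (D' : 'M[R]_(s, t)) : 'M[A]_(r + s, s + t) :=
  block_mx (map_mx polyC D) 0 'X%:M (- map_mx polyC D').

Lemma mul_row_cone r s t (D : 'M[R]_(r, s)) (D' : 'M[R]_(s, t))
    (u : 'rV[A]_r) (v : 'rV[A]_s) :
  row_mx u v *m cone D D' =
  row_mx (u *m map_mx polyC D + 'X *: v) (- (v *m map_mx polyC D')).
Proof. by rewrite mul_row_block mulmx0 add0r mulmxN mul_mx_scalar. Qed.

(** Setting x = 0 puts u(0) in the kernel of D', so u(0) = w D; writing u = u(0) + x u' and
    cancelling x gives v = - u' D'. The equation is only the first block of the next differential;
    in [mx_tail_cone] the second block follows from it. *)
Lemma cone_kernel r s t (D : 'M[R]_(r, s)) (D' : 'M[R]_(s, t))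
    (u : 'rV[A]_s) (v : 'rV[A]_t) :
  exact_mx D D' ->
  u *m map_mx polyC D' + 'X *: v = 0 <-> exists w, w *m cone D D' = row_mx u v.
Proof.
move=> DD'; split=> [uv|[w]]; last first.
  rewrite -[w]hsubmxK mul_row_cone => /eq_row_mx [<- <-].
  rewrite mulmxDl -mulmxA -map_mxM (exact_mx_mul0 DD') map_mx0 mulmx0 add0r.
  by rewrite -scalemxAl scalerN subrr.
have [u' uE] := row_poly_decomp u.
have /DD'[w wE] : map_mx (horner_eval 0) u *m D' = 0.
  rewrite -[D' in LHS]map_polyC_horner0 -map_mxM /=.
  have -> : u *m map_mx polyC D' = - ('X *: v) by apply/eqP; rewrite -addr_eq0 uv.
  by apply/matrixP => i j; rewrite !mxE /horner_eval hornerN hornerM hornerX mul0r oppr0.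
have u0D' : map_mx polyC (map_mx (horner_eval 0) u) *m map_mx polyC D' = 0.
  by rewrite -wE -map_mxM -mulmxA (exact_mx_mul0 DD') mulmx0 map_mx0.
exists (row_mx (map_mx polyC w) u'); rewrite mul_row_cone -map_mxM wE -uE; congr row_mx.
apply/eqP; rewrite eq_sym -addr_eq0; apply/eqP/(monic_scale_mx_eq0 (monicX R)).
rewrite scalerDr scalemxAl -[RHS]uv addrC; congr (_ + _).
by rewrite [in RHS]uE mulmxDl u0D' add0r.
Qed.

Lemma mx_tail_cone m r s t (D : 'M[R]_(r, s)) (D' : 'M[R]_(s, t)) :
  exact_mx D D' -> mx_tail m D' -> mx_tail m.+1 (cone D D').
Proof.
elim: m r s t D D' => [|m IHm] r s t D D' DD' D'T.
  (* Nothing is left below the target of D', so the last differential of the cone has a single block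
     of columns. *)
  exists t, (col_mx (map_mx polyC D') 'X%:M); split=> // w.
  by rewrite -[w]hsubmxK mul_row_col mul_mx_scalar; apply: cone_kernel.
have [q [E [D'E ET]]] := D'T.
exists (t + q)%N, (cone D' E); split; last exact: IHm.
move=> w; rewrite -[w]hsubmxK mul_row_cone; rewrite -(cone_kernel _ _ DD') -row_mx0.
split=> [/eq_row_mx[]//|uv]; rewrite uv; congr row_mx.
have /(cone_kernel _ _ DD')[z] := uv.
rewrite -[z]hsubmxK mul_row_cone => /eq_row_mx [_ <-].
by rewrite mulNmx -mulmxA -map_mxM (exact_mx_mul0 D'E) map_mx0 mulmx0 !oppr0.
Qed.

Lemma mx_mono_split_poly n : mx_mono_split A n.+1 -> mx_mono_split R n.
Proof.
move=> splitA r s D Dinj DT.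
(* With a zero module above the source of D, the cone begins with v |-> (x v, - v D), injective
   because x is regular. *)
have D0 : exact_mx (0 : 'M_(0, r)) D.
  move=> v; split=> [/Dinj->|[w <-]]; first by exists 0; rewrite mulmx0.
  by rewrite mulmx0 mul0mx.
have [|E] := splitA _ _ _ _ (mx_tail_cone D0 DT).
  move=> w; rewrite -[w]hsubmxK mul_row_cone -row_mx0 => /eq_row_mx [].
  rewrite map_mx0 mulmx0 add0r => /(monic_scale_mx_eq0 (monicX R))-> _.
  by rewrite [lsubmx w]thinmx0 row_mx0.
rewrite -[E]submxK mulmx_block scalar_mx_block => /eq_block_mx [_ _ _].
rewrite mul_scalar_mx mulNmx => DE.
exists (- map_mx (horner_eval 0) (drsubmx E)).
rewrite mulmxN -[D in LHS]map_polyC_horner0 -map_mxM.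
apply/matrixP => i j; have /(congr1 (horner_eval 0)) := congr1 (fun M : 'M[A]_r => M i j) DE.
rewrite !mxE /horner_eval hornerD hornerN hornerM hornerX mul0r add0r => ->.
by rewrite -polyC_natr hornerC.
Qed.

(** Multiplication by x is injective, but a splitting would give 0 = 1 at x = 0. *)
Lemma mx_mono_split_poly0 : ~ mx_mono_split A 0.
Proof.
move=> splitA; have [|//|E] := splitA 1%N 1%N 'X%:M.
  by move=> v; rewrite mul_mx_scalar => /(monic_scale_mx_eq0 (monicX R)).
rewrite mul_scalar_mx => /matrixP/(_ 0 0); rewrite !mxE eqxx => /(congr1 (horner_eval 0)).
rewrite /horner_eval hornerM hornerX mul0r hornerC => /eqP.
by rewrite eq_sym oner_eq0.
Qed.

End ConeOfX.

(** * Reduction modulo a monic polynomial *)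

Section Ideals.
Variable S : comNzRingType.
Implicit Types I J : {pred S}.

Lemma idealr_closedD I : idealr_closed I -> {in I &, forall x y, x + y \in I}.
Proof. by move=> [_ _ Il] x y xI yI; rewrite -[x]mul1r Il. Qed.

Lemma idealr_closedMl I : idealr_closed I -> forall a, {in I, forall x, a * x \in I}.
Proof. by move=> [I0 _ Il] a x xI; rewrite -[_ * _]addr0 Il. Qed.

Lemma idealr_closed_subr I : idealr_closed I -> {in I &, forall x y, x - y \in I}.
Proof. by move=> /idealr_closedB[]. Qed.

Lemma maximal_ideal_inv I a : maximal_ideal I -> a \notin I ->
  exists b, 1 - b * a \in I.
Proof.
move=> [Icl Imax] aI; apply: contrapT => nb.
(* This is I + (a); its properness is exactly [nb]. *)
pose J : {pred S} := [pred z | `[< exists b, z - b * a \in I >]].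
have Jcl : idealr_closed J.
  split=> [||c x y].
  - by apply/asboolP; exists 0; rewrite mul0r subr0; case: Icl.
  - by apply/asboolPn.
  - move=> /asboolP[b xb] /asboolP[b' yb']; apply/asboolP; exists (c * b + b').
    by case: Icl => _ _ /(_ c _ _ xb yb'); rewrite mulrBr mulrDl opprD mulrA addrACA.
have IJ : {subset I <= J}.
  by move=> x xI; apply/asboolP; exists 0; rewrite mul0r subr0.
move: aI; rewrite -(Imax J Jcl IJ); case/asboolP.
by exists 1; rewrite mul1r subrr; case: Icl.
Qed.

Lemma maximal_ideal_exists J : idealr_closed J ->
  exists2 I, maximal_ideal I & {subset J <= I}.
Proof.
move=> Jcl; pose T := {I : {pred S} | idealr_closed I /\ {subset J <= I}}.
pose le (I I' : T) := `[< {subset sval I <= sval I'} >].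
have [||C Ctot|M Mmax] :=
    @ZL_preorder T (exist _ J (conj Jcl (fun _ => id))) le.
- by move=> I; apply/asboolP.
- by move=> I I' I'' /asboolP h /asboolP h'; apply/asboolP => x /h /h'.
(* Including J in the union covers the empty chain. *)
- pose U : {pred S} := [pred x | `[< x \in J \/ exists2 I : T, C I & x \in sval I >]].
  have Ucl : idealr_closed U.
    split=> [||a x y].
    + by apply/asboolP; left; case: Jcl.
    + apply/asboolP => -[|[[I [Icl JI]] _]]; first by case: Jcl => _ /negP.
      by have [_ /negP] := Icl.
    + have common (I I' : T) : C I -> C I' -> x \in sval I -> y \in sval I' ->
        exists2 K : T, C K & x \in sval K /\ y \in sval K.
        move=> CI CI' xI yI'; have [/asboolP h|/asboolP h] := Ctot _ _ CI CI'.
          by exists I' => //; split=> //; apply: h.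
        by exists I => //; split=> //; apply: h.
      have inC (K : T) : C K -> x \in sval K -> y \in sval K -> a * x + y \in U.
        move=> CK xK yK; apply/asboolP; right; exists K => //.
        by have [[_ _ Kl] _] := svalP K; apply: Kl.
      move=> /asboolP[xJ|[I CI xI]] /asboolP[yJ|[I' CI' yI']].
      * by apply/asboolP; left; case: Jcl => _ _; apply.
      * by apply: (inC I') => //; apply: (svalP I').2.
      * by apply: (inC I) => //; apply: (svalP I).2.
      * by have [K CK [xK yK]] := common _ _ CI CI' xI yI'; apply: inC CK xK yK.
  have JU : {subset J <= U} by move=> x xJ; apply/asboolP; left.
  exists (exist _ U (conj Ucl JU)) => I CI; apply/asboolP => x xI.
  by apply/asboolP; right; exists I.
case: M Mmax => I [Icl JI] Imax; exists I => //; split=> // K Kcl IK.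
have JK : {subset J <= K} by move=> x /JI/IK.
have /asboolP h := Imax (exist _ K (conj Kcl JK)) (introT (asboolP _) IK).
by move=> x; apply/idP/idP => [/h|/IK].
Qed.

Lemma det_congr_ideal I n (B C : 'M[S]_n) : idealr_closed I ->
  (forall i j, B i j - C i j \in I) -> \det B - \det C \in I.
Proof.
move=> Icl BC; have I0 : 0 \in I by case: Icl.
apply: (big_ind2 (fun x y => x - y \in I)); first by rewrite subrr.
  by move=> x y x' y' xy xy'; rewrite opprD addrACA idealr_closedD.
move=> s _; rewrite -mulrBr idealr_closedMl //.
apply: (big_ind2 (fun x y => x - y \in I)) => // [|x y x' y' xy xy'].
  by rewrite subrr.
rewrite (_ : _ - _ = x' * (x - y) + y * (x' - y')); last first.
  by rewrite !mulrBr addrA [x' * x]mulrC [x' * y]mulrC subrK.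
by rewrite idealr_closedD ?idealr_closedMl.
Qed.

End Ideals.

(** Let c be the contraction of I. Some g in I has a coefficient outside c; modulo c its leading
    coefficient is invertible, and the resulting monic polynomial lifts to I because c[x] lies in
    I. *)
Lemma maximal_ideal_monic (R : comNzRingType) (I : {pred {poly R}}) :
  maximal_ideal I -> maximal_ideal (contraction I) -> exists2 f, f \is monic & f \in I.
Proof.
move=> [Icl Imax] cmax; have [ccl _] := cmax.
have coefI (g : {poly R}) : (forall i, (g`_i)%:P \in I) -> g \in I.
  move=> gI; rewrite -[g]coefK poly_def; have [I0 _ _] := Icl.
  apply: (big_ind (fun x => x \in I)) => // [x y xI yI|i _]; first exact: idealr_closedD.
  by rewrite -mul_polyC mulrC idealr_closedMl.
have [g gI [i gi]] : exists2 g : {poly R}, g \in I & exists i, (g`_i)%:P \notin I.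
  apply: contrapT => nog.
  have {}nog (g : {poly R}) i : g \in I -> (g`_i)%:P \in I.
    by move=> gI; apply: contrapT => gi; apply: nog; exists g => //; exists i; apply/negP.
  (* K is an ideal containing both I and x, so maximality puts x in I, and then its coefficient 1 in
     the contraction. *)
  pose K : {pred {poly R}} := [pred g : {poly R} | (g`_0)%:P \in I].
  have Kcl : idealr_closed K.
    split=> [||a x y xK yK]; rewrite inE ?coef0 ?coefC ?polyC0; try by case: Icl.
    rewrite coefD coef0M polyCD polyCM idealr_closedD //.
    exact: idealr_closedMl.
  have IK : {subset I <= K} by move=> g gI; apply: nog.
  have : 'X \in K by rewrite inE coefX; case: Icl.
  by rewrite (Imax K Kcl IK) => /(nog _ 1%N); rewrite coefX polyC1; case: Icl => _ /negP.
have [|j gj jmax] := @ex_maxnP (fun i => (g`_i)%:P \notin I) (size g) (ex_intro _ i gi).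
  move=> j; apply: contraR; rewrite -ltnNge => sj.
  by rewrite nth_default ?(ltnW sj) // polyC0; case: Icl.
pose g' := take_poly j.+1 g.
have g'I : g' \in I.
  rewrite (_ : g' = g - drop_poly j.+1 g * 'X^(j.+1)); last first.
    by apply/eqP; rewrite eq_sym subr_eq poly_take_drop.
  apply: idealr_closed_subr => //; apply: coefI => k; rewrite coefMXn coef_drop_poly.
  case: ltnP => jk; first by rewrite polyC0; case: Icl.
  by apply: contraT => /jmax; rewrite subnK // leqNgt jk.
have [b bE] : exists b, 1 - b * g`_j \in contraction I by apply: maximal_ideal_inv.
(* The second summand lies in I and corrects the coefficient of x^j to exactly 1. *)
exists (b%:P * g' + (1 - b * g`_j)%:P * 'X^j); last first.
  by apply: idealr_closedD => //; [|rewrite mulrC]; apply: idealr_closedMl.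
rewrite monicE; set f := _ + _.
have fk k : (j <= k)%N -> f`_k = (k == j)%:R.
  rewrite leq_eqVlt !coefD !coefCM coef_take_poly coefXn => /orP[/eqP<-|jk].
    by rewrite ltnSn eqxx mulr1 addrC subrK.
  by rewrite ltnNge jk gtn_eqF // !mulr0 addr0.
suff sf : size f = j.+1 by rewrite lead_coefE sf fk ?eqxx.
apply/eqP; rewrite eqn_leq; apply/andP; split.
  by apply/leq_sizeP => k jk; rewrite fk ?(ltnW jk) // gtn_eqF.
rewrite ltnNge; apply/negP => sf; have := fk j (leqnn _).
by rewrite nth_default // eqxx => /esym/eqP; rewrite oner_eq0.
Qed.

Section ReductionModMonic.
Variables (R : comNzRingType) (f : {poly R}) (e : nat).
Hypotheses (fmon : f \is monic) (fsize : size f = e.+2).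
Local Notation A := {poly R}.

(* 'M[R]_(r, e.+1) models (A / f)^r: row i lists the coefficients of the
   remainder representing the i-th entry. *)
Definition modf r (w : 'rV[A]_r) : 'M[R]_(r, e.+1) :=
  \matrix_i poly_rV (rmodp (w 0 i) f).

Definition liftf r (V : 'M[R]_(r, e.+1)) : 'rV[A]_r := \row_i rVpoly (row i V).

Lemma modf_linear r a (u v : 'rV[A]_r) : modf (a%:P *: u + v) = a *: modf u + modf v.
Proof.
apply/row_matrixP => i; rewrite linearP /= !rowK !mxE.
by rewrite mul_polyC rmodpD // rmodpZ // linearP.
Qed.

Lemma modfD r (u v : 'rV[A]_r) : modf (u + v) = modf u + modf v.
Proof. by rewrite -[u]scale1r -polyC1 modf_linear !scale1r. Qed.

Lemma liftf_linear r a (U V : 'M[R]_(r, e.+1)) :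
  liftf (a *: U + V) = a%:P *: liftf U + liftf V.
Proof. by apply/rowP => i; rewrite !mxE !linearP /= mul_polyC. Qed.

Lemma liftfK r : cancel (@liftf r) (@modf r).
Proof.
move=> V; apply/row_matrixP => i; rewrite rowK mxE rmodp_small ?rVpolyK //.
by rewrite fsize ltnS size_poly.
Qed.

Lemma modfK r (w : 'rV[A]_r) : exists u, w = liftf (modf w) + f *: u.
Proof.
exists (\row_i rdivp (w 0 i) f); apply/rowP => i; rewrite !mxE rowK poly_rV_K.
  by rewrite addrC [f * _]mulrC -rdivp_eq.
by rewrite -ltnS -fsize ltn_rmodp monic_neq0.
Qed.

Lemma modf_mul r (u : 'rV[A]_r) : modf (f *: u) = 0.
Proof.
by apply/row_matrixP => i; rewrite rowK row0 mxE mulrC rmodp_mull // linear0.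
Qed.

Lemma liftf0 r : liftf (0 : 'M_(r, e.+1)) = 0.
Proof. by apply/rowP => i; rewrite !mxE row0 linear0. Qed.

Lemma modf_eq0 r (w : 'rV[A]_r) : modf w = 0 -> exists u, w = f *: u.
Proof.
by move=> w0; have [u] := modfK w; rewrite w0 liftf0 add0r => ?; exists u.
Qed.

Lemma modf_mulmx r s (D : 'M[A]_(r, s)) w : modf (liftf (modf w) *m D) = modf (w *m D).
Proof.
have [u {2}->] := modfK w.
by rewrite mulmxDl -scalemxAl modfD modf_mul addr0.
Qed.

Lemma mulmx_modf_ex r s (D : 'M[A]_(r, s)) :
  exists g : {linear 'M[R]_(r, e.+1) -> 'M[R]_(s, e.+1)},
    forall V, g V = modf (liftf V *m D).
Proof.
apply: linear_ex => a U V.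
by rewrite liftf_linear mulmxDl -scalemxAl modf_linear.
Qed.

(** If V E = f u, regularity of f and E F = 0 give u F = 0, so u = w E and V - f w comes from D.
    Exactness at the next term is consumed too, hence the loss of one degree in
    [exact_tail_modf]. *)
Lemma exact_modf r s t q (D : 'M[A]_(r, s)) (E : 'M[A]_(s, t)) (F : 'M[A]_(t, q)) :
  exact_mx D E -> exact_mx E F -> forall V,
  modf (liftf V *m E) = 0 <-> exists W, modf (liftf W *m D) = V.
Proof.
move=> DE EF V; split=> [/modf_eq0[u uE]|[W <-]]; last first.
  rewrite modf_mulmx -mulmxA (exact_mx_mul0 DE) mulmx0.
  by rewrite -(scaler0 _ f) modf_mul.
have /EF[w wE] : u *m F = 0.
  apply: (monic_scale_mx_eq0 fmon); rewrite scalemxAl -uE -mulmxA (exact_mx_mul0 EF).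
  by rewrite mulmx0.
have /DE[z zE] : (liftf V - f *: w) *m E = 0.
  by rewrite mulmxBl -scalemxAl wE uE subrr.
exists (modf z); rewrite modf_mulmx zE -scalerN modfD modf_mul addr0.
exact: liftfK.
Qed.

Lemma exact_tail_modf m r s (D : 'M[A]_(r, s))
    (g : {linear 'M[R]_(r, e.+1) -> 'M[R]_(s, e.+1)}) :
  (forall V, g V = modf (liftf V *m D)) -> mx_tail m.+1 D -> exact_tail m g.
Proof.
elim: m r s D g => [|m IHm] r s D g gE //= [t [E [DE ET]]].
have [h hE] := mulmx_modf_ex E.
exists 'M[R]_(t, e.+1), h; split; [exact: fg_projective_mx | | exact: IHm hE ET].
have [q [F [EF _]]] := ET.
move=> V; rewrite hE (exact_modf DE EF).
by split=> -[W <-]; exists W; rewrite gE.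
Qed.

Lemma drop_poly_monic : drop_poly e.+1 f = 1.
Proof.
apply/polyP => k; rewrite coef_drop_poly coef1; case: k => [|k].
  by move/monicP: fmon; rewrite lead_coefE fsize.
by rewrite nth_default // fsize addSn ltnS leq_addl.
Qed.

Section TraceForm.
Variables (r : nat) (phi : 'rV[A]_r -> R).
Hypothesis phi_linear : forall a u v, phi (a%:P *: u + v) = a * phi u + phi v.
Hypothesis phi_mul : forall u, phi (f *: u) = 0.

(* Up to f, the polynomials drop_poly i.+1 f are the basis of A / f dual to
   the 'X^i for the functional "coefficient of 'X^e", so this is the A-linear
   map to A / f whose composite with that functional is phi. *)
Definition trace_lift (w : 'rV[A]_r) : A :=
  \sum_(i < e.+1) phi ('X^i *: w) *: drop_poly i.+1 f.

Lemma trace_lift_linear a u v :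
  trace_lift (a%:P *: u + v) = a%:P * trace_lift u + trace_lift v.
Proof.
rewrite mul_polyC scaler_sumr -big_split; apply: eq_bigr => i _ /=.
by rewrite scalerDr scalerA mulrC -scalerA phi_linear scalerDl scalerA.
Qed.

(** The sum [T] below is read in two ways. Its first term is [phi w *: f] and the rest is the lift
    of x w; eliminating its last term by phi (f w) = 0 and applying [dropX] turns it into x times
    the lift of w. *)
Lemma trace_liftX w :
  'X * trace_lift w - trace_lift ('X *: w) = phi w *: f.
Proof.
have phi0 : phi 0 = 0 by have := phi_mul 0; rewrite scaler0.
have phif : \sum_(i < e.+2) phi ('X^i *: w) * f`_i = 0.
  apply: etrans (phi_mul w); rewrite -[X in phi (X *: w)]coefK poly_def fsize; apply: esym.
  apply: (big_rec2 (fun x y => phi (x *: w) = y)); first by rewrite scale0r phi0.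
  move=> i x y _ <-.
  by rewrite -mul_polyC scalerDl -scalerA phi_linear mulrC.
have dropX i : 'X * drop_poly i.+1 f = drop_poly i f - (f`_i)%:P.
  apply/polyP => k; rewrite coefXM coefB coefC !coef_drop_poly.
  by case: k => [|k] /=; rewrite ?subrr // subr0 addSnnS.
pose T := \sum_(i < e.+2) phi ('X^i *: w) *: drop_poly i f.
have -> : 'X * trace_lift w = T.
  rewrite /T big_ord_recr /= drop_poly_monic; move: phif; rewrite big_ord_recr /=.
  move/monicP: fmon; rewrite lead_coefE fsize /= => ->; rewrite mulr1.
  move/eqP; rewrite addrC addr_eq0 => /eqP->.
  rewrite scaleNr scaler_suml -sumrB mulr_sumr; apply: eq_bigr => i _.
  by rewrite -scalerAr dropX scalerBr -[(f`_i)%:P]alg_polyC scalerA.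
rewrite /T big_ord_recl expr0 scale1r drop_poly0l [X in _ - X](_ : _ =
  \sum_(i < e.+1) phi ('X^(bump 0 i) *: w) *: drop_poly (bump 0 i) f) ?addrK //.
by apply: eq_bigr => i _; rewrite scalerA -exprSr.
Qed.

(** The lift is R-linear and, by [trace_liftX], commutes with x up to multiples of f; induction on g
    does the rest. *)
Lemma trace_liftM (I : {pred A}) w g : idealr_closed I -> f \in I ->
  trace_lift (g *: w) - g * trace_lift w \in I.
Proof.
move=> Icl fI; elim/poly_ind: g w => [|g c IHg] w.
  have := trace_lift_linear (-1) 0 0; rewrite !scaler0 addr0 polyCN mulN1r addNr.
  by move=> t0; rewrite scale0r t0 mul0r subr0; case: Icl.
rewrite (_ : (_ *: w) = c%:P *: w + g *: ('X *: w)); last first.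
  by rewrite scalerA addrC -scalerDl.
rewrite trace_lift_linear mulrDl [g * 'X * _ + _]addrC opprD addrACA subrr add0r.
rewrite -mulrA -[trace_lift (g *: _)](subrK (g * trace_lift ('X *: w))) -addrA -mulrBr.
rewrite -[trace_lift ('X *: w) - 'X * _]opprB trace_liftX mulrN -scalerAr -mul_polyC mulrA.
by apply: idealr_closed_subr => //; apply: idealr_closedMl.
Qed.

End TraceForm.

(** [phi j] is the coefficient of x^e in entry j of the R-linear inverse h. Its trace lift is linear
    over R[x] modulo f, and these lifts give the columns of E. *)
Lemma left_inverse_mod_ideal (I : {pred A}) r s (D : 'M[A]_(r, s))
    (g : {linear 'M[R]_(r, e.+1) -> 'M[R]_(s, e.+1)}) :
  idealr_closed I -> f \in I -> (forall V, g V = modf (liftf V *m D)) ->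
  left_invertible g -> exists E, forall i j, (D *m E) i j - (1%:M : 'M_r) i j \in I.
Proof.
move=> Icl fI gE [h hK].
pose phi j (w : 'rV[A]_s) : R := h (modf w) j ord_max.
have phi_lin j a u v : phi j (a%:P *: u + v) = a * phi j u + phi j v.
  by rewrite /phi modf_linear linearP !mxE.
have phi_f j u : phi j (f *: u) = 0 by rewrite /phi modf_mul linear0 mxE.
exists (\matrix_(k, j) trace_lift (phi j) (delta_mx 0 k)) => i j.
(* As h inverts g, this is the coefficient of x^e in entry j of x^k times the i-th unit vector. *)
have phi_row k : (k <= e)%N -> phi j ('X^k *: row i D) = ((k == e) && (i == j))%:R.
  move=> ke; rewrite /phi rowE scalemxAl -modf_mulmx -gE hK !mxE.
  have -> : 'X^k * ((0 == 0 :> 'I_1) && (j == i))%:R = ((i == j)%:R : R) *: 'X^k :> A.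
    by rewrite mulrC -mul_polyC polyC_natr eq_sym.
  rewrite rmodp_small.
    by rewrite coefZ coefXn [_ == k]eq_sym -natrM mulnb andbC.
  by rewrite fsize (leq_ltn_trans (size_scale_leq _ _)) // size_polyXn !ltnS.
(* Only the term of index e survives, and there [drop_poly e.+1 f] is 1. *)
have <- : trace_lift (phi j) (row i D) = (1%:M : 'M_r) i j.
  rewrite /trace_lift big_ord_recr big1 /= => [|k _].
    by rewrite phi_row // eqxx drop_poly_monic add0r mxE scaler_nat.
  by rewrite phi_row ?(ltnW (ltn_ord k)) // ltn_eqF ?scale0r.
rewrite [row i D]row_sum_delta mxE.
have tD u v : trace_lift (phi j) (u + v) = trace_lift (phi j) u + trace_lift (phi j) v.
  by have := trace_lift_linear (phi_lin j) 1 u v; rewrite scale1r mul1r.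
have t0 : trace_lift (phi j) 0 = 0 by apply: (addrI (trace_lift (phi j) 0)); rewrite -tD !addr0.
rewrite (big_morph _ tD t0) -sumrB.
apply: (big_ind (fun x => x \in I)) => [|x y xI yI|k _].
- by case: Icl.
- exact: idealr_closedD.
rewrite !mxE -opprB -mulN1r; apply: idealr_closedMl => //.
exact: trace_liftM.
Qed.

End ReductionModMonic.

(** * Passage from R to R[x] and the equality *)

Lemma hilbert_mx_mono_split (R : comNzRingType) n : hilbert_ring R ->
  proj_mono_split R n -> mx_mono_split {poly R} n.+1.
Proof.
move=> hR splitR r s D Dinj DT; apply: contrapT => noE.
pose J : {pred {poly R}} := [pred a | `[< exists E, D *m E = a%:M >]].
have Jcl : idealr_closed J.
  split=> [||a x y /asboolP[E DE] /asboolP[E' DE']]; first 2 last.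
  - apply/asboolP; exists (a *: E + E').
    by rewrite mulmxDr -scalemxAr DE DE' scale_scalar_mx raddfD.
  - by apply/asboolP; exists 0; rewrite mulmx0 raddf0.
  - exact/asboolPn.
have [I Imax JI] := maximal_ideal_exists Jcl.
have [f fmon fI] := maximal_ideal_monic Imax (hR I Imax).
have [Icl _] := Imax; have [_ I1 _] := Icl.
(* A monic constant is 1, which is not in I, so f has positive degree. *)
have [e fsize] : exists e, size f = e.+2.
  case sf: (size f) => [|[|e]]; last by exists e.
  - by move: (monic_neq0 fmon); rewrite -size_poly_eq0 sf.
  - move: fI; rewrite (size1_polyC (eq_leq sf)).
    by move/monicP: fmon; rewrite lead_coefE sf /= => ->; rewrite (negPf I1).
have [g gE] := mulmx_modf_ex e fmon D.
have ginj V : g V = 0 -> V = 0.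
  rewrite gE => /(modf_eq0 fmon fsize)[u uE].
  have [t [F [DF _]]] := DT.
  have /DF[w wE] : u *m F = 0.
    apply: (monic_scale_mx_eq0 fmon); rewrite scalemxAl -uE -mulmxA.
    by rewrite (exact_mx_mul0 DF) mulmx0.
  have /Dinj/subr0_eq VE : (liftf V - f *: w) *m D = 0.
    by rewrite mulmxBl -scalemxAl wE uE subrr.
  by rewrite -(liftfK fsize V) VE modf_mul.
have ginv : left_invertible g.
  apply: (splitR _ _ g) ginj _; [exact: fg_projective_mx | exact: fg_projective_mx | ].
  exact: exact_tail_modf gE DT.
have [E DE] := left_inverse_mod_ideal fmon fsize Icl fI gE ginv.
have detI : \det (D *m E) \in I.
  by apply/JI/asboolP; exists (E *m \adj (D *m E)); rewrite mulmxA mul_mx_adj.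
have := idealr_closed_subr Icl detI (det_congr_ideal Icl DE).
by rewrite det1 opprB addrC subrK (negPf I1).
Qed.

Theorem theorem4p2 (R : comNzRingType) (hR : hilbert_ring R) :
  fPD {poly R} = enat_succ (fPD R).
Proof.
apply: eq_enat_le => -[|n].
  (* Neither side admits the bound 0: a successor exceeds it, and [mx_mono_split_poly0] excludes it
     for R[x]. *)
  split; last by case: (fPD R).
  by move=> /fPD_le_proj_mono_split/proj_mono_split_mx/mx_mono_split_poly0.
have -> : enat_le_nat (enat_succ (fPD R)) n.+1 = enat_le_nat (fPD R) n by case: (fPD R).
split=> [/fPD_le_proj_mono_split/proj_mono_split_mx|/fPD_le_proj_mono_split].
  by move=> /mx_mono_split_poly/mx_mono_split_proj/proj_mono_split_fPD_le.
by move=> /(hilbert_mx_mono_split hR)/mx_mono_split_proj/proj_mono_split_fPD_le.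
Qed.
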